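(* For all integers $n \ge 1$ and $m \ge 1$, $T(n, \omega \cdot m) = m^n$.
   Context: For a chain (linearly ordered set) $C$ and a finite chain $n=\{0<1<\dots<n-1\}$, let $\mathrm{Emb}(n,C)$ be the set of order embeddings $n \hookrightarrow C$. The big Ramsey degree $T(n,C)$ is the least positive integer $t$ such that for every integer $k \ge 2$ and every coloring $\chi : \mathrm{Emb}(n, C) \to k$ there is a $U \subseteq C$ order-isomorphic to $C$ with $|\chi(\mathrm{Emb}(n, U))| \le t$; if no such $t$ exists, $T(n,C)=\infty$. Here $\omega\cdot m$ is the ordinal product ($m$ copies of $\omega$ placed one after another). *)

(* Defs.v *)
From mathcomp Require Import all_boot all_order.
From mathcomp Require Import boolp classical_sets functions cardinality.

Set Implicit Arguments.
Unset Strict Implicit.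
Unset Printing Implicit Defensive.

Local Open Scope classical_set_scope.
Local Open Scope order_scope.

Record emb (n : nat) (d : Order.disp_t) (C : orderType d) := Emb {
  emb_fun :> 'I_n -> C;
  emb_mono : {mono emb_fun : i j / i <= j}
}.

(* Emb(n, U), as a subset of Emb(n, C) *)
Definition emb_in (n : nat) (d : Order.disp_t) (C : orderType d) (U : set C)
  : set (emb n C) := [set f | range f `<=` U].
Arguments emb_in n {d C} U.

Definition copy_of (d : Order.disp_t) (C : orderType d) (U : set C) : Prop :=
  exists g : C -> C, set_bij [set: C] U g /\ {mono g : x y / x <= y}.

Definition ramsey_bound (n : nat) (d : Order.disp_t) (C : orderType d)
  (t : nat) : Prop :=
  forall (k : nat), (2 <= k)%N -> forall (chi : emb n C -> 'I_k),
    exists U : set C, copy_of U /\ (chi @` emb_in n U #<= `I_t)%card.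

(* None stands for infinity. *)
Definition big_ramsey_degree (n : nat) (d : Order.disp_t) (C : orderType d)
  : option nat :=
  match pselect (exists t : nat, `[< (0 < t)%N /\ ramsey_bound n C t >]) with
  | left ex_t => Some (ex_minn ex_t)
  | right _ => None
  end.

(* Main.v *)
(* If the second coordinates (heights) of an n-subset of omega.m are distinct,
   listing its points by height gives a word of length n over the m copies; there
   are m^n words.  Upper bound: colour an n-subset of omega by the function that
   sends a word w to the colour of the set with word w at these heights.  Ramsey's
   theorem gives an infinite homogeneous set of heights; distributing these
   heights among the m copies gives a copy of omega.m in which all heights are
   distinct and the colour depends on the word only.  Lower bound: colour by
   words.  Any copy of omega.m meets each of the m copies of omega in an infinite
   set, hence realizes every word. *)
Require Import Defs.
From mathcomp Require Import all_boot all_order.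
From mathcomp Require Import boolp classical_sets functions cardinality zify.

Set Implicit Arguments.
Unset Strict Implicit.
Unset Printing Implicit Defensive.

Import Order.TTheory.

(** * Ramsey's theorem on the natural numbers *)

Lemma infinite_enum (P : nat -> Prop) :
    (forall N, exists i, N <= i /\ P i) ->
  exists2 b : nat -> nat, {homo b : x y / x < y} & forall i, P (b i).
Proof.
move=> /choice[h hP].
exists (fun i => iter i (fun x => h x.+1) (h 0)).
  by apply: homo_ltn => [y x z|i /=]; [exact: ltn_trans | exact: (hP _).1].
by case=> [|i] /=; apply: (hP _).2.
Qed.

Lemma infinite_pigeonhole (K : finType) (c : nat -> K) :
  exists k, exists2 b : nat -> nat,
    {homo b : x y / x < y} & forall i, c (b i) = k.
Proof.
suff [k /infinite_enum[b]] : exists k, forall N, exists i, N <= i /\ c i = k.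
  by exists k, b.
apply: contrapT => /forallNP noinf.
have /choice[N hN] : forall k, exists N, forall i, N <= i -> c i <> k.
  move=> k; move/existsNP: (noinf k) => [N /forallNP hN]; exists N => i Ni ci.
  exact: (hN i).
pose M := \max_k N k.
exact: (hN (c M) M (leq_bigmax (c M)) erefl).
Qed.

(** Induction on [n]: along a diagonal sequence the colour of an (n+1)-set depends on its least
    point only, and the pigeonhole principle then makes it constant. *)
Lemma ramsey (K : finType) (n : nat) (c : seq nat -> K) :
  exists f : nat -> nat, {homo f : x y / x < y} /\
    exists k, forall s, sorted ltn s -> size s = n -> c (map f s) = k.
Proof.
elim: n c => [|n IH] c.
  by exists id; split=> //; exists (c [::]) => s _ /size0nil ->.
have /choice[F /all_and2[Fmono /choice[G hG]]] := IH.
(* [E t] enumerates a decreasing chain of infinite sets: [c] is constant on the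
   (n+1)-sets made of the least point [a t] of [E t] and of n points of
   [E t.+1]. *)
pose col e s := c (e 0 :: map (e \o S) s).
pose E := fix E t : nat -> nat :=
  if t is t'.+1 then E t' \o S \o F (col (E t')) else id.
have Emono t : {homo E t : x y / x < y}.
  by elim: t => [|t IHt] x y //= xy; apply: IHt; apply: Fmono.
have Ele t : {mono E t : x y / x <= y} by apply: leq_mono; apply: Emono.
have ES t d x : exists y, E (t + d) x = E t y.
  elim: d x => [|d IHd] x; first by exists x; rewrite addn0.
  rewrite addnS /=; exact: IHd.
pose a t := E t 0.
have amono : {homo a : x y / x < y}.
  apply: homo_ltn => [y x z|t]; first exact: ltn_trans.
  by rewrite /a /=; apply: Emono.
pose kap t := G (col (E t)).
have ckap t s : sorted ltn (t :: s) -> size s = n -> c (map a (t :: s)) = kap t.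
  move=> st ss.
  (* [p d] is the position of the diagonal point [a (t.+1 + d)] in the enumeration [E t.+1]. *)
  have /choice[p hp] d := ES t.+1 d 0.
  have pmono : {homo p : x y / x < y}.
    move=> x y xy; rewrite ltnNge -(Ele t.+1) -!hp -ltnNge.
    by rewrite -!/(a _) amono //; lia.
  pose r := map (p \o subn^~ t.+1) s.
  have sgt : all (ltn t) s.
    by move: st; rewrite /= (path_sortedE ltn_trans) => /andP[].
  have -> : map a (t :: s) = E t 0 :: map (E t \o S) (map (F (col (E t))) r).
    rewrite /= -!map_comp; congr cons; apply/eq_in_map => u us /=.
    rewrite -[LHS]/(E u 0) -[RHS]/(E t.+1 (p (u - t.+1))) -hp subnKC //.
    exact: (allP sgt).
  apply: hG; last by rewrite size_map.
  apply: (homo_sorted_in _ sgt (path_sorted st)) => x y tx ty xy /=.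
  by apply: pmono; rewrite ltn_sub2r // (leq_ltn_trans tx).
have [k [b bmono hb]] := infinite_pigeonhole kap.
exists (a \o b); split; first by move=> x y xy; apply/amono/bmono.
exists k => -[//|x s] xs [ss].
rewrite (map_comp a) /= (ckap (b x) (map b s)) ?size_map ?hb //.
rewrite -[_ :: _]/(map b (x :: s)).
exact: (homo_sorted bmono).
Qed.


(** * Embeddings as increasing lists *)

Lemma enum_ord_sorted n : sorted (fun i j : 'I_n => i < j) (enum 'I_n).
Proof. by have := iota_ltn_sorted 0 n; rewrite -val_enum_ord sorted_map. Qed.

(** Being injective on a finite set, [h] is a permutation, so it maps the increasing enumeration to
    an increasing list of the same elements. *)
Lemma ord_incr_id (n : nat) (h : 'I_n -> 'I_n) :
  {homo h : i j / i < j} -> h =1 id.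
Proof.
move=> hh i.
have hinj : injective h.
  by move=> x y hxy; case: (ltngtP x y) => [/hh|/hh|/val_inj//]; rewrite hxy ltnn.
have : map h (enum 'I_n) = map id (enum 'I_n).
  rewrite map_id; apply: (@irr_sorted_eq _ (fun i j : 'I_n => i < j)).
  - by move=> y x z; apply: ltn_trans.
  - by move=> x; apply: ltnn.
  - exact: (homo_sorted hh _ (enum_ord_sorted n)).
  - exact: enum_ord_sorted.
  - move=> x; rewrite mem_enum; apply/mapP; exists (invF hinj x).
      by rewrite mem_enum.
    by rewrite f_invF.
by move/eq_in_map; apply; rewrite mem_enum.
Qed.

Section Embeddings.
Variables (n : nat) (d : Order.disp_t) (C : orderType d).

Lemma codom_emb_sorted (e : emb n C) : sorted <%O (codom e).
Proof.
apply: homo_sorted (enum_ord_sorted n) => i j.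
by rewrite (leW_mono (emb_mono e)).
Qed.

Lemma codom_emb_inj (e e' : emb n C) : codom e = codom e' -> e = e'.
Proof.
case: e e' => [f hf] [f' hf'] /= ff'.
have {}ff' : f = f'.
  by apply/funext => i; move/eq_in_map: ff'; apply; rewrite mem_enum.
by subst f'; congr Emb; apply: Prop_irrelevance.
Qed.

Lemma emb_of_uniq (l : seq C) :
  uniq l -> size l = n -> exists e : emb n C, codom e = sort <=%O l.
Proof.
move=> ul sl; have sl' : size (sort <=%O l) = n by rewrite size_sort.
case: l => [|x0 l] in ul sl sl' *.
  (* [C] may be empty, so the empty list offers no default point for [nth]. *)
  subst n; pose f (i : 'I_0) : C := False_rect _ (notF (valP i)).
  have fm : {mono f : i j / (i <= j)%O} by case.
  by exists (Emb fm); rewrite /codom /image_mem enum_ord0.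
pose f (i : 'I_n) := nth x0 (sort <=%O (x0 :: l)) i.
have fm : {mono f : i j / (i <= j)%O}.
  move=> i j; rewrite /f lt_sorted_leq_nth ?inE ?sl' ?ltn_ord //.
  by rewrite sort_lt_sorted.
exists (Emb fm); rewrite /codom /image_mem.
apply: (@eq_from_nth _ x0); first by rewrite size_map size_enum_ord sl'.
move=> i; rewrite size_map size_enum_ord => ilt.
rewrite (nth_map (Ordinal ilt)) ?size_enum_ord //= /f.
by rewrite -[i in nth _ (enum _) i]/(val (Ordinal ilt)) nth_ord_enum.
Qed.

(** This moves a colouring to lists, where [ramsey] applies; [k0] colours the lists that come from
    no embedding. *)
Lemma coloring_factor (K : Type) (k0 : K) (chi : emb n C -> K) :
  exists col : seq C -> K, forall e : emb n C, col (codom e) = chi e.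
Proof.
have /choice[col hcol] : forall l, exists k, forall e : emb n C, codom e = l -> chi e = k.
  move=> l; have [[e <-]|noe] := pselect (exists e : emb n C, codom e = l).
    by exists (chi e) => e' /codom_emb_inj ->.
  by exists k0 => e he; case: noe; exists e.
by exists col => e; rewrite -(hcol _ e erefl).
Qed.

End Embeddings.

(** * Words and copies of omega.m *)

Section Words.
Variable m : nat.
Local Notation C := ('I_m *l nat)%type.

(* Listing an n-set by height turns its first coordinates into its word. *)
Definition by_height (l : seq C) : seq (nat *l 'I_m)%type :=
  sort <=%O [seq (p.2, p.1) : (nat *l 'I_m)%type | p <- l].

(** The heights [s] increase strictly, so [zip s w] is already sorted lexicographically. *)
Lemma by_height_zip (w : seq 'I_m) (s : seq nat) :
    sorted ltn s -> size s = size w ->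
  by_height (sort <=%O (zip w s : seq C)) = zip s w.
Proof.
move=> ss sw; rewrite /by_height.
have -> : zip s w = [seq (p.2, p.1) : (nat *l 'I_m)%type | p <- zip w s].
  elim: s w {ss} sw => [|x s IH] [|y w] //= [sw]; by rewrite IH.
apply: (@le_sorted_eq _ (nat *l 'I_m)%type); first exact: sort_le_sorted.
  rewrite sorted_map.
  have : sorted ltn (unzip2 (zip w s)) by rewrite unzip2_zip ?sw.
  rewrite sorted_map; apply: sub_sorted => p q /= pq.
  by rewrite Order.ProdLexiOrder.leEprodlexi /= leEnat (ltnW pq) leqNgt pq.
by rewrite perm_sort; apply: perm_map; rewrite perm_sort.
Qed.

(** Distinct copies of omega go to distinct copies in the same order, so [g] keeps every copy index;
    within a copy its heights increase strictly. *)
Lemma copy_unbounded (U : set C) : copy_of U ->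
  forall i N, exists2 a, N <= a & U (i, a).
Proof.
case=> g [[gU _ _] gmono] i N.
have gltmono := leW_mono gmono.
have g1 (a b : C) : (a < b)%O -> (g a).1 <= (g b).1.
  rewrite -gltmono => /ltW.
  by rewrite Order.ProdLexiOrder.leEprodlexi => /andP[].
have lt2 i0 a b : a < b -> (((i0, a) : C) < ((i0, b) : C))%O.
  move=> ab; rewrite Order.ProdLexiOrder.ltEprodlexi /= lexx /=.
  by rewrite ltEnat.
have g2 (a b : C) : (a < b)%O -> (g a).1 = (g b).1 -> (g a).2 < (g b).2.
  rewrite -gltmono Order.ProdLexiOrder.ltEprodlexi => + ab.
  by rewrite ab lexx /= ltEnat.
have incr (u : nat -> nat) : {homo u : x y / x < y} -> forall x, x <= u x.
  move=> uh; elim=> [//|x IH]; exact: leq_ltn_trans IH (uh _ _ (ltnSn x)).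
(* If g sent two copies of omega to meet in one copy, the part of the first
   beyond the meeting point would be bounded in that copy. *)
have gfst i1 i2 a b : (i1 < i2)%O -> ((g (i1, a)).1 < (g (i2, b)).1)%O.
  move=> i12; rewrite ltNge; apply/negP => le21.
  have lt12 x : (((i1, x) : C) < ((i2, b) : C))%O.
    rewrite Order.ProdLexiOrder.ltEprodlexi /= (ltW i12) /=.
    by rewrite leNgt i12.
  have gc x : (g (i1, a + x)).1 = (g (i2, b)).1.
    apply/val_inj/eqP; rewrite eqn_leq g1 //=.
    apply: leq_trans le21 _; case: x => [|x]; first by rewrite addn0.
    by apply: g1; apply: lt2; lia.
  have uh : {homo (fun x => (g (i1, a + x)).2) : x y / x < y}.
    move=> x y xy; apply: g2; last by rewrite !gc.
    by apply: lt2; lia.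
  have := incr _ uh (g (i2, b)).2.
  by rewrite leqNgt g2 ?gc.
have gid i0 a : (g (i0, a)).1 = i0.
  by apply: (@ord_incr_id m (fun i => (g (i, a)).1)) => x y; apply: gfst.
exists (g (i, N)).2.
  apply: (incr (fun x => (g (i, x)).2)) => x y xy.
  by apply: g2; [apply: lt2 | rewrite !gid].
by rewrite -[X in (X, _)](gid i N) -surjective_pairing; apply: gU.
Qed.

Lemma copy_word (U : set C) (w : seq 'I_m) : copy_of U ->
  exists s, [/\ sorted ltn s, size s = size w
              & forall p, p \in zip w s -> U p].
Proof.
move/copy_unbounded => Uunb.
(* The lower bound [N] lets the induction choose each height above the previous one. *)
suff H N : exists s, [/\ path ltn N s, size s = size w
                       & forall p, p \in zip w s -> U p].
  have [s [ps ss hs]] := H 0; exists s; split=> //; exact: path_sorted ps.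
elim: w N => [|i w IH] N; first by exists [::].
have [a Na Ua] := Uunb i N.+1.
have [s [ps ss hs]] := IH a.
exists (a :: s); split; rewrite /= ?Na ?ss // => p.
by rewrite inE => /predU1P[->|/hs].
Qed.

End Words.

(** * The two bounds *)

Lemma ramsey_bound_lower (n m t : nat) : 0 < m ->
  ramsey_bound n ('I_m *l nat)%type t -> m ^ n <= t.
Proof.
(* Two spare colours make the number of colours at least 2 even if m^n = 1, and a successor, as
   [inord] requires. *)
move=> m0 /(_ (m ^ n).+2 isT) H.
pose word (e : emb n ('I_m *l nat)%type) : n.-tuple 'I_m :=
  insubd (nseq_tuple n (Ordinal m0)) (unzip2 (by_height (codom e))).
have [U [Ucopy]] := H (fun e => inord (enum_rank (word e))).
set A := (X in (X #<= _)%card) => leA.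
rewrite -card_le_II; apply: card_le_trans leA.
apply: card_le_trans (card_image_le (@nat_of_ord _) A).
apply: subset_card_le => i /= ilt.
have ilt' : i < #|{: n.-tuple 'I_m}| by rewrite card_tuple card_ord.
pose w := enum_val (Ordinal ilt').
have [s [ss sw sU]] := copy_word w Ucopy.
have ul : uniq (zip w s : seq ('I_m *l nat)%type).
  apply: (@map_uniq _ _ snd).
  by rewrite -/(unzip2 _) unzip2_zip ?sw // (sorted_uniq ltn_trans ltnn).
have [e he] : exists e : emb n ('I_m *l nat)%type, 
    codom e = sort <=%O (zip w s : seq ('I_m *l nat)%type).
  apply: emb_of_uniq => //; by rewrite size2_zip ?sw ?size_tuple.
have we : word e = w.
  apply: val_inj; rewrite /word he by_height_zip // unzip2_zip ?sw //.
  by rewrite val_insubd size_tuple eqxx.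
exists (inord (enum_rank (word e))).
  exists e => // _ [j _ <-]; apply: sU.
  by have := codom_f e j; rewrite he mem_sort.
by rewrite we /w enum_valK inordK //=; apply: ltnW; apply: ltnW.
Qed.

Lemma ramsey_bound_upper (n m : nat) : ramsey_bound n ('I_m *l nat)%type (m ^ n).
Proof.
case=> [//|k] _ chi.
have [col hcol] := coloring_factor ord0 chi.
have [f [fmono [phi hphi]]] := ramsey n (fun s : seq nat =>
  [ffun w : n.-tuple 'I_m => col (sort <=%O (zip w s : seq ('I_m *l nat)%type))]).
have fle := leq_mono fmono.
(* [key] deals the natural numbers out to the copies by residue modulo [m], increasingly within each
   copy. *)
pose key (p : 'I_m *l nat) := m * p.2 + p.1.
have key_inj : injective key.
  case=> [i a] [j b]; rewrite /key /= => eq_ab.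
  have m0 : 0 < m by apply: leq_ltn_trans (ltn_ord i).
  have ij : i = j.
    apply: val_inj; move/(congr1 (modn^~ m)): eq_ab.
    by rewrite ![m * _]mulnC !modnMDl !modn_small.
  by move: eq_ab; rewrite ij => /addIn/eqP; rewrite eqn_pmul2l // => /eqP ->.
pose g (p : 'I_m *l nat) : ('I_m *l nat)%type := (p.1, f (key p)).
have gmono : {mono g : p q / (p <= q)%O}.
  case=> i a [j b]; rewrite !Order.ProdLexiOrder.leEprodlexi /=.
  case: (ltgtP i j) => //= ->; rewrite !leEnat fle /key /= leq_add2r.
  by rewrite leq_pmul2l //; apply: leq_ltn_trans (ltn_ord j).
exists (range g); split.
  exists g; split=> //; split=> // p q _ _.
  exact: inc_inj gmono _ _.
(* [psi] lists the colours [phi] gives to the m^n words; every colour on [range g] is shown to be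
   among them. *)
pose psi i := nth ord0 (map phi (enum {: n.-tuple 'I_m})) i.
apply: card_le_trans (card_image_le psi _); apply: subset_card_le => _ [e eU <-].
have /choice[p_ hp] : forall i, exists p, g p = e i.
  by move=> i; have [|p _ <-] := eU (e i); [exists i | exists p].
have p_inj : injective p_.
  move=> i j pij; have : e i = e j by rewrite -!hp pij.
  by move/(inc_inj (emb_mono e)).
(* As [f] increases, sorting the preimages by [key] sorts their images by height; the first
   coordinates then spell the word of [e]. *)
pose l := sort (relpre key leq) (codom p_).
have sl : size l = n by rewrite size_sort size_codom card_ord.
have lsort : sorted ltn (map key l).
  rewrite ltn_sorted_uniq_leq sorted_map; apply/andP; split; last first.
    by apply: sort_sorted => x y; apply: leq_total.
  rewrite map_inj_uniq ?sort_uniq; last exact: key_inj.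
  by apply/injectiveP.
have wP : size (map fst l) == n by rewrite size_map sl.
pose w := Tuple wP.
exists (index w (enum {: n.-tuple 'I_m})).
  rewrite /= -[X in _ < X ^ _](card_ord m) -(card_tuple n) cardE.
  by rewrite index_mem mem_enum.
rewrite /psi (nth_map w) ?index_mem ?mem_enum // nth_index ?mem_enum //.
rewrite -(hphi (map key l)) ?size_map // ffunE -hcol; congr col.
have -> : zip w (map f (map key l)) = map g l.
  by rewrite /= -map_comp zip_map.
rewrite (_ : codom e = map g (codom p_)); last first.
  by rewrite -map_comp; apply: eq_map => j /=; rewrite hp.
rewrite -[RHS](sort_le_id (T := ('I_m *l nat)%type)).
  by apply/perm_sort_leP/perm_map; rewrite perm_sort.
rewrite -map_comp (eq_map hp).
by case/andP: (lt_sorted_is_uniq_le (codom_emb_sorted e)).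
Qed.

(* 'I_m *l nat is lexicographic with the copy index first: the ordinal
   product of omega and m. *)
Theorem theorem4p8 (n m : nat) (hn : (1 <= n)%N) (hm : (1 <= m)%N) :
  big_ramsey_degree n ('I_m *l nat)%type = Some (m ^ n)%N.
Proof.
rewrite /big_ramsey_degree; case: pselect => [ex_t|[]]; last first.
  exists (m ^ n); apply/asboolP; split; last exact: ramsey_bound_upper.
  by rewrite expn_gt0 hm.
congr Some; case: ex_minnP => t /asboolP[_ bt] tmin.
apply/eqP; rewrite eqn_leq ramsey_bound_lower // andbT.
apply: tmin; apply/asboolP; split; last exact: ramsey_bound_upper.
by rewrite expn_gt0 hm.
Qed.
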